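(* Let $(X,\tau)$ be a compact Hausdorff space of countable tightness. Then for every sufficiently large regular cardinal $\theta$ and every countably closed elementary submodel $M\prec H(\theta)$ with $X,\tau\in M$, the space $X\cap M$ with the subspace topology inherited from $X$ (equivalently, the space $X_M$) is normal.
   Context: A space $X$ has countable tightness if whenever $A\subseteq X$ and $x\in\overline{A}$, there is a countable $B\subseteq A$ with $x\in\overline{B}$. $H(\theta)$ is the set of all sets of hereditary cardinality less than $\theta$. ''Sufficiently large'' means: there is a cardinal $\theta_0$ depending only on $(X,\tau)$ such that the assertion holds for all regular $\theta\geq\theta_0$ (so that $H(\theta)$ contains all sets of interest). $M$ is countably closed if every countable sequence of elements of $M$ belongs to $M$, i.e. $M^\omega\subseteq M$. $X_M$ denotes the set $X\cap M$ with the topology $\tau_M$ generated by $\{U\cap M: U\in\tau\cap M\}$; it is known that, under the present hypotheses, $\tau_M$ coincides with the subspace topology that $X\cap M$ inherits from $X$. *)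

(* Defs.v *)
From HB Require Import structures.
From mathcomp Require Import all_boot all_classical.
From mathcomp Require Import topology.

Set Implicit Arguments.
Unset Strict Implicit.
Unset Printing Implicit Defensive.

Local Open Scope classical_set_scope.
Local Open Scope card_scope.
Local Open Scope quotient_scope.

(** The universe of sets [V]: well-founded trees (Aczel's encoding) modulo
    bisimilarity, so that equality in [V] is Leibniz equality. Every family of
    elements of [V] indexed by a type one universe level down is a set
    ([set_of]); with the classical axioms, [V] satisfies ZFC (with replacement
    and separation for arbitrary predicates). *)

Inductive tree := Node (I : Type) of I -> tree.

HB.instance Definition _ := gen_eqMixin tree.
HB.instance Definition _ := gen_choiceMixin tree.

Fixpoint bisim (s t : tree) : Prop :=
  let: Node J f := s in let: Node K g := t in
  (forall i, exists j, bisim (f i) (g j)) /\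
  (forall j, exists i, bisim (f i) (g j)).

Lemma bisim_refl t : bisim t t.
Proof. by elim: t => I f IH; split => i; exists i. Qed.

Lemma bisim_sym s t : bisim s t -> bisim t s.
Proof.
elim: s t => I f IH [J g] /= [h1 h2]; split.
  by move=> j; have [i ?] := h2 j; exists i; exact: IH.
by move=> i; have [j ?] := h1 i; exists j; exact: IH.
Qed.

Lemma bisim_trans s t u : bisim s t -> bisim t u -> bisim s u.
Proof.
elim: s t u => I f IH [J g] [K h] /= [a1 a2] [b1 b2]; split.
  move=> i; have [j ?] := a1 i; have [k ?] := b1 j.
  by exists k; apply: (IH _ (g j)).
move=> k; have [j ?] := b2 k; have [i ?] := a2 j.
by exists i; apply: (IH _ (g j)).
Qed.

Definition bisimb : rel tree := fun s t => `[< bisim s t >].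

Lemma bisimb_equiv : equiv_class_of bisimb.
Proof.
split.
- by move=> t; apply/asboolP/bisim_refl.
- by move=> s t; apply/asboolP/asboolP; exact: bisim_sym.
- by move=> t s u /asboolP st /asboolP tu; apply/asboolP/(bisim_trans st).
Qed.

Canonical bisimb_equivRel := EquivRelPack bisimb_equiv.

Definition V := {eq_quot bisimb}.

HB.instance Definition _ := Choice.on V.

Definition indexV (x : V) : Type := let: Node J _ := repr x in J.

Definition eltV (x : V) : indexV x -> V :=
  match repr x as t return (let: Node J _ := t in J) -> V with
  | Node J f => fun i => \pi_V (f i)
  end.

Definition memV (y x : V) : Prop := exists i : indexV x, eltV i = y.

Definition elts (x : V) : set V := [set y | memV y x].

Definition set_of (I : Type) (f : I -> V) : V :=
  \pi_V (Node (fun i => repr (f i))).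

Lemma memE (x y : V) :
  memV y x <-> let: Node J f := repr x in exists i, bisim (f i) (repr y).
Proof.
rewrite /memV /eltV /indexV; case: (repr x) => I f; split=> -[i].
  move=> <-; exists i; apply/asboolP.
  by have /eqmodP := esym (reprK (\pi_V (f i))).
by move=> h; exists i; rewrite -[y]reprK; apply/eqmodP/asboolP.
Qed.

Lemma mem_set_of (I : Type) (f : I -> V) y :
  memV y (set_of f) <-> exists i, f i = y.
Proof.
rewrite memE /set_of.
have /eqmodP/asboolP := esym (reprK (\pi_V (Node (fun i => repr (f i))))).
case: (repr _) => J g /= [h1 h2]; split.
  move=> [j gy]; have [i fg] := h2 j; exists i.
  rewrite -[LHS]reprK -[RHS]reprK; apply/eqmodP/asboolP.
  exact: bisim_trans fg gy.
move=> [i <-]; have [j fg] := h1 i; exists j; exact: bisim_sym.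
Qed.

Lemma V_ext (x y : V) : (forall z, memV z x <-> memV z y) -> x = y.
Proof.
move=> h; rewrite -[LHS]reprK -[RHS]reprK; apply/eqmodP/asboolP.
have {}h z := iff_trans (iff_sym (memE x z)) (iff_trans (h z) (memE y z)).
case: (repr x) (repr y) h => I f [J g] h.
have rK t : bisim t (repr (\pi_V t)).
  by apply/asboolP; have /eqmodP := esym (reprK (\pi_V t)).
split=> k.
  have [j ?] := (h (\pi_V (f k))).1 (ex_intro _ k (rK _)).
  by exists j; apply: bisim_trans (rK _) (bisim_sym _).
have [i ?] := (h (\pi_V (g k))).2 (ex_intro _ k (rK _)).
by exists i; apply: bisim_trans _ (bisim_sym (rK _)).
Qed.

Lemma V_ind (P : V -> Prop) :
  (forall x, (forall y, memV y x -> P y) -> P x) -> forall x, P x.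
Proof.
move=> IH x; rewrite -[x]reprK; elim: (repr x) => I f IHf; apply: IH => y.
have /eqmodP/asboolP := esym (reprK (\pi_V (Node f))).
rewrite memE; case: (repr _) => J g /= [_ h2] [j gy]; have [i fg] := h2 j.
suff -> : y = \pi_V (f i) by exact: IHf.
rewrite -[LHS]reprK; apply/eqmodP/asboolP/bisim_sym.
exact: bisim_trans fg gy.
Qed.

(** Sequences in [V]: functions with domain omega, as sets of Kuratowski
    pairs. *)

Definition emptyV : V := set_of (fun i : void => match i with end).

Definition succV (x : V) : V :=
  set_of (fun o : option (indexV x) => if o is Some i then eltV i else x).

Fixpoint natV (n : nat) : V := if n is m.+1 then succV (natV m) else emptyV.

Definition upairV (x y : V) : V := set_of (fun b : bool => if b then x else y).

Definition opairV (x y : V) : V := upairV (upairV x x) (upairV x y).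

Definition seqV (s : nat -> V) : V := set_of (fun n => opairV (natV n) (s n)).

Lemma mem_emptyV y : ~ memV y emptyV.
Proof. by move/mem_set_of => -[]. Qed.

Lemma mem_succV x y : memV y (succV x) <-> memV y x \/ y = x.
Proof.
rewrite mem_set_of; split=> [[[i|] <-]|[[i <-]|->]].
- by left; exists i.
- by right.
- by exists (Some i).
- by exists None.
Qed.

Lemma mem_upairV x y z : memV z (upairV x y) <-> z = x \/ z = y.
Proof.
rewrite mem_set_of; split=> [[[] <-]|[->|->]]; [by left|by right| |].
- by exists true.
- by exists false.
Qed.

(** Cardinals are von Neumann initial ordinals. *)

Definition transitive_set (A : set V) : Prop :=
  forall x, A x -> elts x `<=` A.

Definition card_lt (A B : set V) : Prop := A #<= B /\ A #!= B.

Definition is_ordinal (a : V) : Prop :=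
  transitive_set (elts a) /\ forall b, memV b a -> transitive_set (elts b).

Definition is_cardinal (k : V) : Prop :=
  is_ordinal k /\ forall a, memV a k -> elts a #!= elts k.

Definition cofinal_in (A : set V) (k : V) : Prop :=
  A `<=` elts k /\ forall a, memV a k -> exists2 b, A b & elts a `<=` elts b.

Definition is_regular (k : V) : Prop :=
  [/\ is_cardinal k, infinite_set (elts k) &
      forall A : set V, cofinal_in A k -> A #= elts k].

Definition trcl (x : V) : set V := smallest transitive_set (elts x).

Definition Hset (theta : V) : set V := [set x | card_lt (trcl x) (elts theta)].

(** First-order formulas in the language {membership, equality}, with
    variables named by natural numbers. *)

Inductive formula : Type :=
| FMem of nat & nat
| FEq of nat & nat
| FNot of formula
| FAnd of formula & formula
| FEx of nat & formula.

Definition update (e : nat -> V) (n : nat) (a : V) : nat -> V :=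
  fun m => if m == n then a else e m.

Fixpoint sat (M : set V) (phi : formula) (e : nat -> V) : Prop :=
  match phi with
  | FMem i j => memV (e i) (e j)
  | FEq i j => e i = e j
  | FNot p => ~ sat M p e
  | FAnd p q => sat M p e /\ sat M q e
  | FEx n p => exists2 a, M a & sat M p (update e n a)
  end.

Definition elementary_submodel (M N : set V) : Prop :=
  M `<=` N /\
  forall (phi : formula) (e : nat -> V), (forall n, M (e n)) ->
    sat M phi e <-> sat N phi e.

Definition countably_closed (M : set V) : Prop :=
  forall s : nat -> V, (forall n, M (s n)) -> M (seqV s).

(** Topological spaces that are elements of [V], and the induced topology on
    the type of their points. *)

Definition opens (tau : V) : set_system V := elts @` elts tau.

Record is_topology (X tau : V) : Prop := IsTopology {
  opens_sub : forall A, opens tau A -> A `<=` elts X;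
  opens_empty : opens tau set0;
  opens_full : opens tau (elts X);
  opens_setI : setI_closed (opens tau);
  opens_bigcup : forall D : set_system V, D `<=` opens tau ->
    opens tau (\bigcup_(A in D) A)
}.

Definition space (X tau : V) (tauP : is_topology X tau) : Type :=
  set_type (elts X).

Section space_topology.
Variables (X tau : V) (tauP : is_topology X tau).

HB.instance Definition _ := Choice.on (space tauP).

Definition pointV (p : space tauP) : V := \val p.

Definition space_open : set_system (space tauP) :=
  [set pointV @^-1` A | A in opens tau].

Lemma space_openT : space_open setT.
Proof.
exists (elts X); first exact: opens_full.
by apply/seteqP; split=> // p _; exact: set_mem (valP p).
Qed.

Lemma space_openI : setI_closed space_open.
Proof.
move=> _ _ [A oA <-] [B oB <-]; exists (A `&` B) => //.
exact: (opens_setI tauP).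
Qed.

Lemma space_open_bigU (I : Type) (f : I -> set (space tauP)) :
  (forall i, space_open (f i)) -> space_open (\bigcup_i f i).
Proof.
move=> of_; pose D := [set A | opens tau A /\ exists i, pointV @^-1` A = f i].
exists (\bigcup_(A in D) A).
  by apply: (opens_bigcup tauP) => A [].
apply/seteqP; split=> [p [A [oA [i fiA]] Ap]|p [i _ fip]].
  by exists i => //; rewrite -fiA.
have [A oA fiA] := of_ i; exists A; first by split=> //; exists i.
by move: fip; rewrite -fiA.
Qed.

HB.instance Definition _ := isOpenTopological.Build (space tauP)
  space_openT space_openI space_open_bigU.

Lemma open_spaceE (U : set (space tauP)) : open U = space_open U.
Proof. by []. Qed.

End space_topology.

Definition countably_tight (T : topologicalType) : Prop :=
  forall (A : set T) (x : T), closure A x ->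
    exists B : set T, [/\ B `<=` A, countable B & closure B x].

(** As a type, [space_cap tauP M] carries the library's subspace topology, the
    initial topology of its inclusion in [space tauP]. *)
Definition space_cap (X tau : V) (tauP : is_topology X tau) (M : set V) :
  set (space tauP) := [set p | M (pointV p)].

Arguments space_cap {X tau} tauP M.

(* Main.v *)
(** If F and G are closed in X ∩ M and their closures in X share a point, then
    by countable tightness so do the closures of two sequences s in F and t in
    G. Both sequences belong to M, hence by elementarity the closures of s and
    t also share a point of M, which lies in F and in G. So disjoint closed
    sets of X ∩ M have disjoint closures in X, and normality descends from the
    compact Hausdorff space X. *)

Require Import Defs.
From mathcomp Require Import all_boot all_classical.
From mathcomp Require Import topology.

Local Open Scope classical_set_scope.

(** * Hereditary cardinality *)

Lemma trcl_sub (x y : V) : memV y x -> trcl y `<=` trcl x.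
Proof.
move=> yx; apply: smallest_sub.
  by move=> u xu v vu A [trA sA]; apply: (trA u) => //; exact: xu.
by move=> u uy A [trA sA]; apply: (trA y) => //; exact: sA.
Qed.

Lemma card_lt_sub (A B C : set V) : A `<=` B -> card_lt B C -> card_lt A C.
Proof.
move=> AB [BC nBC]; have AC := card_le_trans (subset_card_le AB) BC.
split=> //; apply/negP => AeC; move/negP: nBC; apply.
(* Cantor-Bernstein: [C #<= A] and [A #<= B] would give [C #<= B]. *)
rewrite card_eq_le BC; apply: card_le_trans (subset_card_le AB).
by move: AeC; rewrite card_eq_le => /andP[].
Qed.

(** Transitivity is what makes formulas with bounded quantifiers absolute between [Hset theta] and
    [V]. *)
Lemma Hset_transitive (theta : V) : transitive_set (Hset theta).
Proof. by move=> x Hx y yx; apply: card_lt_sub Hx; exact: trcl_sub. Qed.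

Lemma is_cardinal_emptyV : is_cardinal emptyV.
Proof.
by split; [split|]; move=> a /mem_emptyV.
Qed.

(** * Adherence to a sequence as a first-order property *)

(* The second component of a Kuratowski pair is the set lying in exactly one of
   its elements; this needs no mention of the first component. *)
Definition sole (q z : V) : Prop :=
  (exists2 u, memV u q & memV z u) /\
  forall u v, memV u q -> memV v q -> memV z u -> memV z v -> u = v.

(* For m = x the pair is {{x}}, so there too x lies in exactly one element. *)
Lemma sole_opairV (m x z : V) : sole (opairV m x) z <-> z = x.
Proof.
have mp u : memV u (opairV m x) <-> u = upairV m m \/ u = upairV m x.
  exact: mem_upairV.
split=> [[[u /mp uq zu] h]|->].
  have : z = m \/ z = x.
    by case: uq zu => -> /mem_upairV []; auto.
  case=> // zm; have e : upairV m m = upairV m x.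
    apply: h; try (apply/mp; by [left|right]);
      by apply/mem_upairV; left.
  have : memV x (upairV m m) by rewrite e; apply/mem_upairV; right.
  by rewrite zm => /mem_upairV [] ->.
split.
  by exists (upairV m x); [apply/mp; right|apply/mem_upairV; right].
have aux u : memV u (opairV m x) -> memV x u -> u = upairV m x.
  by move/mp => [->|->] // /mem_upairV [] ->.
by move=> u v uq vq xu xv; rewrite (aux u) // (aux v).
Qed.

(** The range is recovered from the graph through [sole] alone, so a formula can speak of it without
    defining natural numbers or pairs. *)
Lemma seqV_range (s : nat -> V) (z : V) :
  (exists2 q, memV q (seqV s) & sole q z) <-> range s z.
Proof.
split=> [[q /mem_set_of [n <-] /sole_opairV ->]|[n _ <-]]; first by exists n.
exists (opairV (natV n) (s n)); first by apply/mem_set_of; exists n.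
exact/sole_opairV.
Qed.

(** Closure in terms of the members of [tau], hence expressible by a formula about elements of
    [V]. *)
Definition adherent (tau y : V) (B : set V) : Prop :=
  forall U, memV U tau -> memV y U -> exists2 z, memV z U & B z.

Definition FAll (n : nat) (p : formula) : formula := FNot (FEx n (FNot p)).
Definition FImp (p q : formula) : formula := FNot (FAnd p (FNot q)).

Lemma sat_FAnd A p q e : sat A (FAnd p q) e <-> sat A p e /\ sat A q e.
Proof. by []. Qed.

Lemma sat_FAll A n p e :
  sat A (FAll n p) e <-> forall a, A a -> sat A p (update e n a).
Proof.
split=> [h a Aa|h [a Aa]]; last by apply; exact: h.
by apply: contrapT => na; apply: h; exists a.
Qed.

Lemma sat_FImp A p q e : sat A (FImp p q) e <-> (sat A p e -> sat A q e).
Proof.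
split=> [h pe|h [pe]]; last by apply; exact: h.
by apply: contrapT => nq; apply: h.
Qed.

(* Variable 6 is the z of [sole], variable 7 its q. *)
Definition sole_formula : formula :=
  FAnd (FEx 8 (FAnd (FMem 8 7) (FMem 6 8)))
       (FAll 8 (FAll 9 (FImp (FMem 8 7) (FImp (FMem 9 7)
          (FImp (FMem 6 8) (FImp (FMem 6 9) (FEq 8 9))))))).

(* Variable 1 is the topology, 4 the point, and i the sequence. *)
Definition adherent_formula (i : nat) : formula :=
  FAll 5 (FImp (FMem 5 1) (FImp (FMem 4 5)
    (FEx 6 (FAnd (FMem 6 5) (FEx 7 (FAnd (FMem 7 i) sole_formula)))))).

Lemma sat_sole A e : transitive_set A -> A (e 7) ->
  sat A sole_formula e <-> sole (e 7) (e 6).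
Proof.
move=> trA Aq; rewrite /sole_formula.
split=> [/sat_FAnd[[u _ [uq zu]] /sat_FAll h]|[[u uq zu] h]].
  split; first by exists u.
  move=> a b aq bq za zb.
  have /sat_FAll/(_ b (trA _ Aq _ bq)) := h a (trA _ Aq _ aq).
  by do 4 (move/sat_FImp; move=> /(_ ltac:(assumption))).
apply/sat_FAnd; split; first by exists u => //; exact: (trA _ Aq).
apply/sat_FAll => a _; apply/sat_FAll => b _.
by do 4 (apply/sat_FImp => ?); exact: h.
Qed.

(** All quantifiers are bounded by members of the transitive set [A], so the witnesses [U], [z] and
    [q] lie in [A]. The bound [i < 4] keeps variable [i] apart from the point 4 and the bound
    variables 5 to 9. *)
Lemma sat_adherent A e (s : nat -> V) i : (i < 4)%N ->
  transitive_set A -> A (e 1) -> A (e i) -> e i = seqV s ->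
  sat A (adherent_formula i) e <-> adherent (e 1) (e 4) (range s).
Proof.
move=> i4 trA A1 Ai ei.
have ne k : (4 <= k)%N -> (i == k) = false.
  by move=> k4; apply/negbTE; rewrite neq_ltn (leq_trans i4 k4).
split=> [/sat_FAll h U Ut yU|h].
  have /sat_FImp/(_ Ut)/sat_FImp/(_ yU) [z _ [zU [q Aq [qi]]]] :=
    h U (trA _ A1 _ Ut).
  move/(sat_sole _ _ trA Aq) => sq; exists z => //; apply/seqV_range.
  by exists q => //; move: qi; rewrite /= /update /= !ne // ei.
apply/sat_FAll => U AU; apply/sat_FImp => Ut; apply/sat_FImp => yU.
have [z zU /seqV_range [q qs sq]] := h U Ut yU.
have Aq : A q by apply: (trA _ Ai); rewrite ei.
exists z; first exact: (trA _ AU).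
split=> //; exists q => //; split; last exact/sat_sole.
by rewrite /= /update /= !ne // ei.
Qed.

Lemma elementary_common_adherent (M N : set V) (X tau : V) (s t : nat -> V) :
  transitive_set N -> elementary_submodel M N -> countably_closed M ->
  M X -> M tau -> (forall n, M (s n)) -> (forall n, M (t n)) ->
  (exists y, [/\ memV y X, adherent tau y (range s)
    & adherent tau y (range t)]) ->
  exists y, [/\ M y, memV y X, adherent tau y (range s)
    & adherent tau y (range t)].
Proof.
move=> trN [MN el] cM MX Mtau Ms Mt [y [yX ys yt]].
have MS := cM _ Ms; have MT := cM _ Mt.
(* Countable closure has put both sequences in [M], so they may serve as parameters. The variables
   above 3 get the filler [seqV t], because every value of [e] must lie in [M]. *)
pose e k := match k with 0 => X | 1 => tau | 2 => seqV s | _ => seqV t end.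
have Me k : M (e k) by case: k => [|[|[|k]]].
pose body := FAnd (FMem 4 0) (FAnd (adherent_formula 2) (adherent_formula 3)).
have bodyP a : sat N body (update e 4 a) <->
    [/\ memV a X, adherent tau a (range s) & adherent tau a (range t)].
  have h2 : sat N (adherent_formula 2) (update e 4 a) <->
    adherent tau a (range s) by apply: sat_adherent => //; exact: MN.
  have h3 : sat N (adherent_formula 3) (update e 4 a) <->
    adherent tau a (range t) by apply: sat_adherent => //; exact: MN.
  by split=> [[? [/h2 ? /h3 ?]]|[? /h2 ? /h3 ?]].
have /(el (FEx 4 body) e Me) [a Ma] : sat N (FEx 4 body) e.
  exists y; first exact: (trN _ (MN _ MX) _ yX).
  exact/bodyP.
(* [M] need not be transitive, so [body] cannot be decoded there; a second use of elementarity
   carries its truth at [a] back to the transitive [N]. *)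
move/(el body (update e 4 a)) => h.
have /h/bodyP[] : forall n, M (update e 4 a n).
  by move=> n; rewrite /update; case: ifP.
by exists a.
Qed.

(** * Closures in the space and countable tightness *)

Lemma space_closureE (X tau : V) (tauP : is_topology X tau)
    (B : set (space tauP)) (x : space tauP) :
  closure B x <-> adherent tau (pointV x) (@pointV _ _ tauP @` B).
Proof.
split=> [clBx U Ut xU|h C].
  have [z [Bz zU]] : B `&` @pointV _ _ tauP @^-1` elts U !=set0.
    apply: clBx; apply: open_nbhs_nbhs; split=> //.
    by rewrite open_spaceE; exists (elts U) => //; exists U.
  by exists (pointV z) => //; exists z.
rewrite nbhsE => -[O []]; rewrite open_spaceE => -[_ [U Ut <-] <-] xU sC.
have [_ /[swap] -[z Bz <-] zU] := h U Ut xU.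
by exists z; split=> //; exact: sC.
Qed.

Lemma countable_range (T : Type) (B : set T) :
  B !=set0 -> countable B -> exists f : nat -> T, B = range f.
Proof.
move=> [b Bb] /pfcard_geP [B0|[f]]; first by move: Bb; rewrite B0.
by exists f; apply/esym; exact: image_eq.
Qed.

Lemma adherent_sequence {X tau : V} {tauP : is_topology X tau}
    (tightX : countably_tight (space tauP)) (A : set (space tauP)) x :
  closure A x -> exists s : nat -> space tauP,
    (forall n, A (s n)) /\
    adherent tau (pointV x) (range (@pointV _ _ tauP \o s)).
Proof.
move=> /tightX [B [BA cB clBx]].
(* [B] is nonempty because [x] adheres to it; only then can a total sequence enumerate it. *)
have [b [Bb _]] := clBx setT filterT.
have [s Bs] := countable_range _ _ (ex_intro _ b Bb) cB.
exists s; split; first by move=> n; apply: BA; rewrite Bs; exists n.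
by move/space_closureE: clBx; rewrite Bs image_comp.
Qed.

Lemma closures_meet_in_cap {X tau : V} {tauP : is_topology X tau}
    (tightX : countably_tight (space tauP)) (M N : set V)
    (F G : set (space tauP)) :
  transitive_set N -> elementary_submodel M N -> countably_closed M ->
  M X -> M tau -> F `<=` space_cap tauP M -> G `<=` space_cap tauP M ->
  closure F `&` closure G !=set0 ->
  closure F `&` closure G `&` space_cap tauP M !=set0.
Proof.
move=> trN el cM MX Mtau FM GM [x [/(adherent_sequence tightX) [s [Fs xs]]]].
move=> /(adherent_sequence tightX) [t [Gt xt]].
have Xx : memV (pointV x) X by exact: set_mem (valP x).
have [|||y [My yX ys yt]] := elementary_common_adherent
    M N X tau (@pointV _ _ tauP \o s) (@pointV _ _ tauP \o t)
    trN el cM MX Mtau.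
- by move=> n; exact/FM.
- by move=> n; exact/GM.
- by exists (pointV x).
pose p : space tauP := SigSub (mem_set (yX : elts X y)).
have sub (A : set (space tauP)) (r : nat -> space tauP) :
    (forall n, A (r n)) -> adherent tau y (range (@pointV _ _ tauP \o r)) ->
    closure A p.
  move=> Ar yr; apply/space_closureE => U Ut yU.
  have [_ /[swap] -[n _ <-] zU] := yr U Ut yU.
  by exists (pointV (r n)) => //; exists (r n).
by exists p; split=> //; split; [exact: sub ys|exact: sub yt].
Qed.

(** * Normality of a subspace *)

Lemma initial_closure {T : topologicalType} {Y : set T} (A : set Y) (y : Y) :
  closure (set_val @` A) (set_val y) -> closure A y.
Proof.
move=> cl C; rewrite nbhsE => -[O [[W oW <-] Wy] OC].
have [_ [[a Aa <-] Wa]] := cl W (open_nbhs_nbhs (conj oW Wy)).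
by exists a; split=> //; exact: OC.
Qed.

Lemma normal_set_type (T : topologicalType) (Y : set T) :
  normal_space T ->
  (forall F G : set T, F `<=` Y -> G `<=` Y ->
    closure F `&` closure G !=set0 -> closure F `&` closure G `&` Y !=set0) ->
  normal_space (set_type Y).
Proof.
move=> nT disj A cA B /set_nbhsP [U [oU AU UB]].
have subY (S : set Y) : set_val @` S `<=` Y.
  by move=> _ [y _ <-]; exact: set_mem (valP y).
have clAG : closure (set_val @` A) `<=` ~` closure (set_val @` (~` U)).
  move=> x clA clG.
  have [|z [[clA' clG'] Yz]] := disj _ _ (subY A) (subY (~` U)).
    by exists x.
  pose y : Y := SigSub (mem_set Yz).
  have Ay : A y.
    by apply: cA; exact: initial_closure.
  have : (~` U) y by apply: (open_closedC oU); exact: initial_closure.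
  by apply; exact: AU.
have [C /set_nbhsP [W [oW AW WC]] clC] :
    filter_from (set_nbhs (closure (set_val @` A))) closure
      (~` closure (set_val @` (~` U))).
  apply: nT; first exact: closed_closure.
  apply/set_nbhsP; exists (~` closure (set_val @` (~` U))); split=> //.
  exact/closed_openC/closed_closure.
exists (set_val @^-1` W).
  apply/set_nbhsP; exists (set_val @^-1` W); split=> //; first by exists W.
  by move=> y Ay; apply/AW/subset_closure; exists y.
(* If [y] were outside [U], it would lie both in [closure C] and in the closure of the complement of
   [U], against [clC]. *)
move=> y cly; apply: UB; apply: contrapT => nU.
apply: (clC (set_val y)); last by apply: subset_closure; exists y.
move=> O /initial_continuous nO.
by have [z [/WC Cz Oz]] := cly _ nO; exists (set_val z).
Qed.

Theorem theorem2p2 (X tau : V) (tauP : is_topology X tau)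
    (compactX : compact [set: space tauP])
    (hausdorffX : hausdorff_space (space tauP))
    (tightX : countably_tight (space tauP)) :
  exists2 theta0 : V, is_cardinal theta0 &
    forall theta : V, is_regular theta -> elts theta0 `<=` elts theta ->
    forall M : set V, elementary_submodel M (Hset theta) ->
      countably_closed M -> M X -> M tau ->
    normal_space (set_type (space_cap tauP M)).
Proof.
(* As [M] is a subset of [Hset theta], having [X] and [tau] in [M] already places them in
   [Hset theta], so the threshold can be the cardinal 0. *)
exists emptyV; first exact: is_cardinal_emptyV.
move=> theta _ _ M el cM MX Mtau; apply: normal_set_type.
  exact: compact_normal.
move=> F G FM GM; apply: (closures_meet_in_cap tightX) el cM MX Mtau FM GM.
exact: Hset_transitive.
Qed.
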